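(* For all integers $r\ge 1$, $$\mathsf{cap}(G^1_r)=1-\frac1{D_1(r)},\qquad \mathsf{cap}(G^\infty_r)=1-\frac1{(r+1)^2},$$ where $D_1(r)$ is the size of a maximum anticode of diameter $r$ in $\mathbb Z^2$ in the $l_1$ metric, and $$D_1(r)=\begin{cases}\dfrac{(r+1)^2}{2}, & r \text{ odd},\\[2mm] \dfrac{r^2}{2}+r+1, & r\text{ even}.\end{cases}$$
   Context: Metrics on $\mathbb Z^2$: $d_1((i_1,j_1),(i_2,j_2))=|i_1-i_2|+|j_1-j_2|$ and $d_\infty((i_1,j_1),(i_2,j_2))=\max\{|i_1-i_2|,|j_1-j_2|\}$. An anticode of diameter $r$ is a subset of $\mathbb Z^2$ in which any two points are at distance at most $r$. For $\alpha\in\{1,\infty\}$, $G^\alpha_r$ is the graph on $\mathbb Z^2$ in which each vertex is joined to all other vertices at $d_\alpha$-distance at most $r$; equivalently it is the graph $\mathbb Z^2_R$ with recovery set $R=\{z\in\mathbb Z^2: 1\le d_\alpha(z,0)\le r\}$. Capacity: fix a finite alphabet $Q$ of size $q\ge 2$. For a finite $R\subset\mathbb Z^2\setminus\{0\}$, an $R$-recoverable system on $\mathbb Z^2$ is a nonempty set $X\subseteq Q^{\mathbb Z^2}$ such that for every $v\in\mathbb Z^2$ there is a function $f_v:Q^{|R|}\to Q$ with $x_v=f_v(x_{v+R})$ for all $x\in X$. Its rate is $\limsup_{n\to\infty}\frac1{n^2}\log_q|\mathcal B_{[n]^2}(X)|$, where $\mathcal B_{[n]^2}(X)$ is the set of restrictions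 of the words of $X$ to $[n]^2=\{0,\dots,n-1\}^2$. The capacity of the graph is the supremum of the rates over all $R$-recoverable systems $X\subseteq Q^{\mathbb Z^2}$. *)

(* Defs.v *)
From HB Require Import structures.
From mathcomp Require Import all_boot all_order all_algebra zify.
From mathcomp Require Import all_classical all_reals all_analysis.

Set Implicit Arguments.
Unset Strict Implicit.
Unset Printing Implicit Defensive.

Import Order.TTheory GRing.Theory Num.Theory.
Local Open Scope classical_set_scope.
Local Open Scope ring_scope.

Notation Z2 := (int * int)%type.

Definition d1 (u v : Z2) : nat := (`|u.1 - v.1| + `|u.2 - v.2|)%N.
Definition dinf (u v : Z2) : nat := maxn `|u.1 - v.1|%N `|u.2 - v.2|%N.

Definition anticode (d : Z2 -> Z2 -> nat) (r : nat) (A : set Z2) : Prop :=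
  forall u v, A u -> A v -> (d u v <= r)%N.

Definition maximum_anticode (d : Z2 -> Z2 -> nat) (r : nat) (A : set Z2) :
    Prop :=
  anticode d r A /\ forall B, anticode d r B -> (B #<= A)%card.

(* In particular maximum anticodes exist and are finite; at most one [D]
   satisfies this. *)
Definition max_anticode_size (d : Z2 -> Z2 -> nat) (r D : nat) : Prop :=
  exists2 A, maximum_anticode d r A & (A #= `I_D)%card.

(* The recovery set of the graph in which [v] is joined to every other vertex
   at [d]-distance at most [r]; for the adjacency relation itself, see
   [ball_graph_d1P] and [ball_graph_dinfP]. *)
Definition ball_graph (d : Z2 -> Z2 -> nat) (r : nat) : set Z2 :=
  [set z | (1 <= d z 0%R <= r)%N].

(* [f v] is a function Q^R -> Q, applied to the word read off at [v + R]. *)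
Definition recoverable (Q : finType) (R : set Z2) (X : set (Z2 -> Q)) : Prop :=
  X !=set0 /\
  exists f : Z2 -> (R -> Q) -> Q,
    forall v x, X x -> x v = f v (fun z : R => x (v + val z)).

Definition restriction (Q : finType) (n : nat) (x : Z2 -> Q) :
    {ffun 'I_n * 'I_n -> Q} :=
  [ffun i : 'I_n * 'I_n => x ((i.1 : nat)%:Z, (i.2 : nat)%:Z)].

Definition blocks (Q : finType) (n : nat) (X : set (Z2 -> Q)) :
    set {ffun 'I_n * 'I_n -> Q} :=
  restriction n @` X.
Arguments blocks {Q} n X _.

(* The term at [n = 0] is irrelevant to the limit superior. *)
Definition rate (K : realType) (Q : finType) (X : set (Z2 -> Q)) : \bar K :=
  limn_esup (fun n : nat =>
    ((n%:R ^+ 2)^-1 * (ln (#|blocks n X|%:R) / ln (#|Q|%:R)))%:E).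

Definition capacity (K : realType) (Q : finType) (R : set Z2) : \bar K :=
  ereal_sup [set rate K X | X in @recoverable Q R].

Lemma ball_graph_d1P r (v w : Z2) :
  ball_graph d1 r (w - v) <-> w <> v /\ (d1 v w <= r)%N.
Proof.
case: v w => [a b] [c e]; rewrite /ball_graph /d1 /=; split.
  by move=> /andP[h1 h2]; split; [case=> ? ?; subst; lia | lia].
move=> [ne h]; apply/andP; split; last by lia.
rewrite lt0n; apply/eqP => h0; apply: ne; congr pair; lia.
Qed.

Lemma ball_graph_dinfP r (v w : Z2) :
  ball_graph dinf r (w - v) <-> w <> v /\ (dinf v w <= r)%N.
Proof.
case: v w => [a b] [c e]; rewrite /ball_graph /dinf /=; split.
  by move=> /andP[h1 h2]; split; [case=> ? ?; subst; lia | lia].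
move=> [ne h]; apply/andP; split; last by lia.
rewrite lt0n; apply/eqP => h0; apply: ne; congr pair; lia.
Qed.

Lemma finite_ball_graph_dinf r : finite_set (ball_graph dinf r).
Proof.
pose s := [seq (i%:Z - r%:Z, j%:Z - r%:Z) : int * int
            | i <- iota 0 (r + r).+1, j <- iota 0 (r + r).+1].
apply: (@sub_finite_set _ _ [set` s]); last exact: finite_seq.
move=> [a b]; rewrite /ball_graph /dinf /= => h.
apply/allpairsP; exists (absz (a + r%:Z), absz (b + r%:Z)).
by split; rewrite ?mem_iota /=; [lia | lia | congr pair; lia].
Qed.

Lemma finite_ball_graph_d1 r : finite_set (ball_graph d1 r).
Proof.
apply: sub_finite_set (finite_ball_graph_dinf r) => -[a b].
rewrite /ball_graph /d1 /dinf /=; lia.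
Qed.

(* Main.v *)
Require Import Defs.
From mathcomp Require Import all_boot all_order all_algebra.
From mathcomp Require Import all_classical all_reals all_analysis.
From mathcomp Require Import zify ring.

(* Both bounds come from one combinatorial object: a lattice of index [D] in
   Z^2 whose nonzero points have length greater than [r], together with an
   anticode [A] of diameter [r] and size [D].  Distinct points of [A] lie in
   distinct cosets, so [A] tiles the plane with translations in the lattice.
   - Any anticode of diameter [r] meets each coset at most once, so [A] is
     maximum.
   - Each coset is an independent set of the graph, so the letters on a coset
     inside the box are determined by the remaining ones; by pigeonhole some
     coset has density at least about 1/D in the box.
   - Imposing one parity check on each tile gives a recoverable system, since
     a tile is a clique, and only one letter per tile is lost. *)

Set Implicit Arguments.
Unset Strict Implicit.
Unset Printing Implicit Defensive.

Import Order.TTheory GRing.Theory Num.Theory.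
Local Open Scope classical_set_scope.
Local Open Scope ring_scope.

(** * Limits superior and rates of growth *)

Lemma limn_esup_le_near (K : realType) (u : nat -> \bar K) (l : K) :
  (forall e : K, 0 < e -> \forall n \near \oo, (u n <= (l + e)%:E)%E) ->
  (limn_esup u <= l%:E)%E.
Proof.
move=> h; apply/lee_addgt0Pr => e e0.
apply: (@le_trans _ _ (ereal_sup (u @` [set n | (u n <= (l + e)%:E)%E]))).
  apply: ereal_inf_lbound; exists [set n | (u n <= (l + e)%:E)%E] => //.
  exact: h.
by apply: ge_ereal_sup => _ [n /= un <-]; rewrite -EFinD.
Qed.

Lemma limn_esup_ge_near (K : realType) (u : nat -> \bar K) (l : K) :
  (forall e : K, 0 < e -> \forall n \near \oo, ((l - e)%:E <= u n)%E) ->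
  (l%:E <= limn_esup u)%E.
Proof.
move=> h; apply: le_ereal_inf_tmp => _ [V Voo <-].
apply/lee_addgt0Pr => e e0.
have [n [Vn un]] : exists n, V n /\ ((l - e)%:E <= u n)%E.
  have [N _ hN] : \forall n \near \oo, V n /\ ((l - e)%:E <= u n)%E.
    by near=> n; split; near: n => //; exact: h.
  by exists N; exact: (hN N (leqnn N)).
rewrite -leeBlDr // -EFinB; apply: le_trans un _.
by apply: ereal_sup_ubound; exists n.
Unshelve. all: by end_near. Qed.

Lemma near_div_le (K : realType) (c e : K) : 0 < e ->
  \forall n \near \oo, (0 < n)%N /\ c / n%:R <= e.
Proof.
move=> e0; near=> n; split; first by near: n; exact: nbhs_infty_gt.
have n0 : 0 < n%:R :> K by rewrite ltr0n; near: n; exact: nbhs_infty_gt.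
rewrite ler_pdivrMr // mulrC -ler_pdivrMr //; apply: ltW.
by near: n; exact: nbhs_infty_gtr.
Unshelve. all: by end_near. Qed.

Section Rate.
Variables (K : realType) (Q : finType) (X : set (Z2 -> Q)) (D C : nat).
Hypotheses (hQ : (2 <= #|Q|)%N) (D0 : (0 < D)%N).

Let q0 : 0 < #|Q|%:R :> K. Proof. by rewrite ltr0n ltnW. Qed.
Let lnq0 : 0 < ln (#|Q|%:R) :> K. Proof. by rewrite ln_gt0 // ltr1n. Qed.

(** The exponent [m] is at most (1 - 1/D) n^2 + (C/D) n, written in [nat] without division or
    subtraction; the linear term is a boundary effect that vanishes after division by n^2. *)
Lemma rate_le : X !=set0 ->
  (forall n, exists2 m, (#|blocks n X| <= #|Q| ^ m)%N &
    (m * D + n ^ 2 <= n ^ 2 * D + C * n)%N) ->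
  (rate K X <= (1 - 1 / D%:R)%:E)%E.
Proof.
move=> [x Xx] h; apply: limn_esup_le_near => e e0.
near=> n.
have [n0 hC] : (0 < n)%N /\ (C%:R / D%:R) / n%:R <= e.
  by near: n; exact: near_div_le.
have [m hm hD] := h n; rewrite lee_fin.
have b0 : 0 < #|blocks n X|%:R :> K.
  rewrite ltr0n; apply/card_gt0P; exists (restriction n x).
  by rewrite inE; exists x.
have nR : 0 < n%:R :> K by rewrite ltr0n.
have DR : 0 < D%:R :> K by rewrite ltr0n.
have le_m : ln #|blocks n X|%:R / ln #|Q|%:R <= m%:R :> K.
  rewrite ler_pdivrMr // mulr_natl -lnXn // ler_ln ?posrE ?exprn_gt0 //.
  by rewrite -natrX ler_nat.
have hD' : m%:R * D%:R + n%:R ^+ 2 <= n%:R ^+ 2 * D%:R + C%:R * n%:R :> K.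
  by rewrite -!natrX -!natrM -!natrD ler_nat.
rewrite mulrC ler_pdivrMr ?exprn_gt0 //; apply: le_trans le_m _.
apply: (@le_trans _ _ ((1 - 1 / D%:R + C%:R / D%:R / n%:R) * n%:R ^+ 2));
  last by rewrite ler_pM2r ?exprn_gt0 // lerD2l.
rewrite -(ler_pM2r DR); set rhs := leRHS.
suff -> : rhs = n%:R ^+ 2 * D%:R + C%:R * n%:R - n%:R ^+ 2 by rewrite lerBrDr.
by rewrite /rhs; field; rewrite !gt_eqF.
Unshelve. all: by end_near. Qed.

Lemma rate_ge :
  (forall n, exists2 m, (#|Q| ^ m <= #|blocks n X|)%N &
    (n ^ 2 * D <= m * D + n ^ 2 + C * n)%N) ->
  ((1 - 1 / D%:R)%:E <= rate K X)%E.
Proof.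
move=> h; apply: limn_esup_ge_near => e e0.
near=> n.
have [n0 hC] : (0 < n)%N /\ (C%:R / D%:R) / n%:R <= e.
  by near: n; exact: near_div_le.
have [m hm hD] := h n; rewrite lee_fin.
have nR : 0 < n%:R :> K by rewrite ltr0n.
have DR : 0 < D%:R :> K by rewrite ltr0n.
have b0 : 0 < #|blocks n X|%:R :> K.
  by rewrite ltr0n; apply: leq_trans hm; rewrite expn_gt0 ltnW.
have le_m : m%:R <= ln #|blocks n X|%:R / ln #|Q|%:R :> K.
  rewrite ler_pdivlMr // mulr_natl -lnXn // ler_ln ?posrE ?exprn_gt0 //.
  by rewrite -natrX ler_nat.
have hD' : n%:R ^+ 2 * D%:R <= m%:R * D%:R + n%:R ^+ 2 + C%:R * n%:R :> K.
  by rewrite -!natrX -!natrM -!natrD ler_nat.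
rewrite [leRHS]mulrC ler_pdivlMr ?exprn_gt0 //; apply: le_trans le_m.
apply: (@le_trans _ _ ((1 - 1 / D%:R - C%:R / D%:R / n%:R) * n%:R ^+ 2)).
  by rewrite ler_pM2r ?exprn_gt0 // lerD2l lerN2.
rewrite -(ler_pM2r DR); set lhs := leLHS.
suff -> : lhs = n%:R ^+ 2 * D%:R - C%:R * n%:R - n%:R ^+ 2.
  by rewrite !lerBlDr (le_trans hD') // addrAC.
by rewrite /lhs; field; rewrite !gt_eqF.
Unshelve. all: by end_near. Qed.

End Rate.

(** * Recoverability as determination by the neighbours *)

Lemma recoverable_determined (Q : finType) (R : set Z2) (X : set (Z2 -> Q))
    (v : Z2) (x y : Z2 -> Q) :
  recoverable R X -> X x -> X y -> (forall z, R z -> x (v + z) = y (v + z)) ->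
  x v = y v.
Proof.
move=> [_ [f hf]] Xx Xy h; rewrite (hf v x Xx) (hf v y Xy); congr f.
by apply/funext => z; apply: h; exact: set_valP.
Qed.

(** The recovery function returns the letter at [v] of any word of [X] that shows the given pattern;
    the hypothesis makes the choice immaterial. For patterns that never occur, [x0 0] is a mere
    default. *)
Lemma determined_recoverable (Q : finType) (R : set Z2) (X : set (Z2 -> Q)) :
  X !=set0 ->
  (forall v x y, X x -> X y -> (forall z, R z -> x (v + z) = y (v + z)) ->
    x v = y v) ->
  recoverable R X.
Proof.
move=> X0 h; split => //; have [x0 _] := X0.
exists (fun v w => xget (x0 0) [set s | exists2 x, X x &
  x v = s /\ w = (fun z : R => x (v + val z))]) => v x Xx.
case: xgetP => [s _ [y Xy [<- e]]|/(_ (x v))]; last by case; exists x.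
apply: h => // z Rz.
by have := congr1 (fun g => g (SigSub (mem_set Rz))) e; rewrite /=.
Qed.

Lemma absz_add_inner (n r i : nat) (a : int) :
  (`|a| <= r)%N -> (r <= i < n - r)%N ->
  (`|(i%:Z + a)%R| < n)%N /\ `|(i%:Z + a)%R|%N%:Z = i%:Z + a.
Proof. by lia. Qed.

Lemma absz_add_outer (n r i : nat) (a : int) :
  (`|a| <= r)%N -> (i < n)%N ->
  (`|(i%:Z + a + r%:Z)%R| < n + 2 * r)%N /\
  `|(i%:Z + a + r%:Z)%R|%N%:Z = i%:Z + a + r%:Z.
Proof. by lia. Qed.

(** * Tilings by an anticode along a lattice *)

Section Perfect.
Variables (d : Z2 -> Z2 -> nat) (r : nat) (F : finType) (phi : Z2 -> F).
Variable A : seq Z2.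
Hypotheses (d00 : d 0 0 = 0%N) (d_sub : forall u v, d u v = d (u - v) 0)
  (dinf_le : forall u v, (dinf u v <= d u v)%N).
(** By [phi_shift] the fibres of [phi] are the cosets of a subgroup, the class of 0; this class is
    called the lattice below. *)
Hypotheses
  (phi_shift : forall u v w, phi u = phi v -> phi (u + w) = phi (v + w))
  (phi_sep : forall u v, phi u = phi v -> u <> v -> (r < d u v)%N).
Hypotheses (uniqA : uniq A) (sizeA : size A = #|F|) (A0 : 0 \in A)
  (anticodeA : anticode d r [set` A]).

Let phi_inj u v : (d u v <= r)%N -> phi u = phi v -> u = v.
Proof.
by move=> le e; apply/eqP/negPn/negP => /eqP /(phi_sep e); rewrite ltnNge le.
Qed.

(** Separation makes [phi] injective on [A], and [A] has as many points as there are classes. *)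
Let phi_surj c : exists2 a, a \in A & phi a = c.
Proof.
suff : c \in map phi A by move=> /mapP[a Aa ->]; exists a.
have um : uniq (map phi A).
  by rewrite map_inj_in_uniq // => u v Au Av; apply/phi_inj/anticodeA.
have le : (size (enum F) <= size (map phi A))%N.
  by rewrite -cardE size_map sizeA.
have [_ e] := uniq_min_size um (fun x _ => mem_enum F x) le.
by rewrite e mem_enum.
Qed.

Let rep c := nth 0 A (index c (map phi A)).

Let index_phi c : (index c (map phi A) < size A)%N.
Proof.
rewrite -(size_map phi) index_mem; have [a aA <-] := phi_surj c.
exact: map_f.
Qed.

Let rep_mem c : rep c \in A. Proof. exact: mem_nth. Qed.

Let phi_rep c : phi (rep c) = c.
Proof.
rewrite /rep -(nth_map _ (phi 0)) // nth_index // -index_mem size_map.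
exact: index_phi.
Qed.

Let gt0_dist u v : u <> v -> (0 < d u v)%N.
Proof.
move=> ne; apply: leq_trans (dinf_le u v); rewrite lt0n; apply/eqP => h.
apply: ne; move: u v h => [a b] [a' b']; rewrite /dinf /= => h.
by congr pair; lia.
Qed.

Let box z : (d z 0%R <= r)%N -> (`|z.1| <= r)%N /\ (`|z.2| <= r)%N.
Proof.
move=> zr; have := leq_trans (dinf_le _ _) zr.
by rewrite /dinf geq_max !subr0 => /andP[].
Qed.

Let ball_sub u v : u <> v -> (d u v <= r)%N -> ball_graph d r (u - v).
Proof. by move=> ne le; rewrite /ball_graph /= -d_sub le gt0_dist. Qed.

(** Replacing each point by the representative of its class in [A] is injective on every anticode of
    diameter [r]. *)
Lemma perfect_max_anticode_size : max_anticode_size d r #|F|.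
Proof.
exists [set` A]; last first.
  have img : nth 0 A @` `I_#|F| = [set` A].
    rewrite -sizeA; apply/seteqP; split => [_ [i /= lt <-]|a /= aA].
      exact: mem_nth.
    by exists (index a A); rewrite /= ?index_mem ?nth_index.
  rewrite -img; apply: inj_card_eq => i j; rewrite !inE -sizeA => iA jA /eqP.
  by rewrite nth_uniq // => /eqP.
split => // B antiB.
have injB : {in B &, injective (rep \o phi)}.
  move=> u v; rewrite !inE => Bu Bv /= /(congr1 phi); rewrite !phi_rep.
  exact/phi_inj/antiB.
have := inj_card_eq injB; rewrite card_eq_le => /andP[_ /card_le_trans]; apply.
by apply: subset_card_le => _ [u _ <-]; exact: rep_mem.
Qed.

(** * Upper bound by pigeonhole over the cosets *)

Section Recoverable.
Variables (Q : finType) (hQ : (2 <= #|Q|)%N).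

(** These are the positions whose whole [r]-neighbourhood stays in the box. *)
Definition inner n : {set 'I_n * 'I_n} :=
  [set p : 'I_n * 'I_n | (r <= p.1 < n - r)%N && (r <= p.2 < n - r)%N]%SET.

Lemma card_inner n : (n ^ 2 <= #|inner n| + 4 * r * n)%N.
Proof.
pose I : {set 'I_n} := [set i : 'I_n | (r <= i < n - r)%N]%SET.
have -> : inner n = finset.setX I I by apply/setP => -[i j]; rewrite !inE.
suff le_I : (n - 2 * r <= #|I|)%N.
  rewrite cardsX -mulnn.
  apply: leq_trans (leq_add (leq_mul le_I le_I) (leqnn _)).
  (* For n <= 2r the truncated difference is 0, but then 4rn is already at least n^2. *)
  have [le|lt] := leqP n (2 * r).
    by apply: leq_trans (leq_addl _ _); rewrite leq_mul2r; lia.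
  have -> : n = (n - 2 * r + 2 * r)%N by lia.
  by rewrite addnK; nia.
have lt (i : 'I_(n - 2 * r)) : (i + r < n)%N by have := ltn_ord i; lia.
rewrite -[leqLHS]card_ord -cardsT -(@card_imset _ _ (fun i => Ordinal (lt i))).
  apply: subset_leq_card; apply/fintype.subsetP => _ /imsetP[i _ ->].
  by rewrite inE /=; have := ltn_ord i; lia.
by move=> i j [] /addIn/val_inj.
Qed.

Let pt n (p : 'I_n * 'I_n) : Z2 := ((p.1 : nat)%:Z, (p.2 : nat)%:Z).

(** Overwriting the letters on [S] by a constant is injective on the blocks of [X], because the
    other letters determine them; what remains is a function on the complement of [S]. *)
Lemma card_blocks_le (X : set (Z2 -> Q)) n (S : {set 'I_n * 'I_n}) :
  (forall x y, X x -> X y -> {in ~: S, forall p, x (pt p) = y (pt p)} ->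
    {in S, forall p, x (pt p) = y (pt p)}) ->
  (#|blocks n X| <= #|Q| ^ (n ^ 2 - #|S|))%N.
Proof.
move=> h; have /card_gt0P [q0 _] : (0 < #|Q|)%N by exact: ltnW.
pose g (b : {ffun 'I_n * 'I_n -> Q}) :=
  [ffun p => if p \in S then q0 else b p].
have <- : #|pffun_on q0 (mem (~: S)) (mem [set: Q]%SET)|
    = (#|Q| ^ (n ^ 2 - #|S|))%N.
  by rewrite card_pffun_on cardsT; congr (_ ^ _)%N;
    rewrite [LHS]cardsCs finset.setCK card_prod !card_ord.
rewrite -(@card_in_imset _ _ g); last first.
  move=> b b'; rewrite !inE => -[x Xx <-] [y Xy <-] /ffunP e.
  have e' : {in ~: S, forall p, x (pt p) = y (pt p)}.
    by move=> p; rewrite inE => /negbTE pS; have := e p; rewrite !ffunE pS.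
  apply/ffunP => p; rewrite !ffunE.
  have [pS|pS] := boolP (p \in S); first exact: (h _ _ Xx Xy).
  by apply: e'; rewrite inE.
apply: subset_leq_card; apply/fintype.subsetP => _ /imsetP[b _ ->].
apply/pffun_onP; split.
  by apply/supportP => p; rewrite inE negbK => pS; rewrite ffunE pS.
by move=> q _; rewrite inE.
Qed.

Lemma exists_large_class n :
  exists c,
    (#|inner n| <= #|F| * #|[set p in inner n | phi (pt p) == c]%SET|)%N.
Proof.
pose S c := [set p in inner n | phi (pt p) == c]%SET.
exists [arg max_(c > phi 0) #|S c|].
case: arg_maxnP => // c _ cmax.
rewrite -sum1_card (partition_big (fun p => phi (pt p)) xpredT) //=.
rewrite -sum_nat_const; apply: leq_sum => c' _.
by rewrite sum1dep_card; exact: cmax.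
Qed.

Lemma rate_perfect_le (K : realType) (X : set (Z2 -> Q)) :
  recoverable (ball_graph d r) X -> (rate K X <= (1 - 1 / #|F|%:R)%:E)%E.
Proof.
(* The constant is the boundary loss in [card_inner]: the chosen class [S] satisfies |F| |S| >= n^2
   - 4rn. *)
move=> rX; apply: (@rate_le _ _ _ _ (4 * r)%N) => //.
- by apply/card_gt0P; exists (phi 0).
- by case: rX.
move=> n; have [c hc] := exists_large_class n.
set S := [set p in _ | _]%SET in hc.
have hS : (#|S| <= n ^ 2)%N.
  by apply: leq_trans (max_card _) _; rewrite card_prod !card_ord.
exists (n ^ 2 - #|S|)%N; last first.
  rewrite mulnBl; have := leq_mul hS (leqnn #|F|); have := card_inner n.
  by rewrite mulnC in hc; lia.
apply: card_blocks_le => x y Xx Xy h p; rewrite inE => /andP[pin /eqP pc].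
apply: (recoverable_determined rX Xx Xy) => z /andP[z1 zr].
have [ar br] := box zr.
move: pin; rewrite inE => /andP[in1 in2].
have [lt1 e1] := absz_add_inner ar in1; have [lt2 e2] := absz_add_inner br in2.
have e : pt p + z = pt (Ordinal lt1, Ordinal lt2).
  by apply: injective_projections; rewrite /= ?e1 ?e2.
(* The neighbour lies in the box; it is outside [S] because two points of one class are more than
   [r] apart. *)
rewrite e; apply: h; rewrite !inE -e negb_and; apply/orP; right.
apply/eqP => ec.
have : (r < d (pt p + z)%R (pt p))%N.
  apply: phi_sep; first by rewrite ec pc.
  move=> /eqP; rewrite -subr_eq0 addrAC subrr add0r => /eqP z0.
  by move: z1; rewrite z0 d00.
by rewrite d_sub addrAC subrr add0r ltnNge zr.
Qed.

(** * Lower bound by a parity check on each tile *)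

Section ParityCode.
Variables (V : zmodType) (e : Q -> V) (e' : V -> Q).
Hypotheses (eK : cancel e e') (e'K : cancel e' e).

Definition parity_code : set (Z2 -> Q) :=
  [set x | forall c, phi c = phi 0 -> \sum_(a <- A) e (x (c + a)) = 0].

(** The letters at lattice points serve as check symbols; all others stay free. *)
Let fill (y : Z2 -> Q) z :=
  if phi z == phi 0 then e' (- \sum_(a <- A | a != 0) e (y (z + a))) else y z.

Let fill_parity y : parity_code (fill y).
Proof.
move=> c c0; rewrite (bigD1_seq 0) //= addr0 /fill c0 eqxx e'K.
rewrite big_seq_cond [in X in _ + X]big_seq_cond.
apply/eqP; rewrite addrC subr_eq0; apply/eqP.
apply: eq_bigr => a /andP[aA a0]; case: ifP => // /eqP ca.
(* The only lattice point of [A] is 0, so in each tile [fill] changes only the base letter. *)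
have /phi_inj a00 : phi a = phi 0.
  by rewrite -ca -[a in LHS]add0r; apply: phi_shift.
by rewrite a00 ?eqxx // in a0; exact: anticodeA.
Qed.

(** Subtracting from [v] the point of [A] in its class gives the base of a tile through [v]. The
    other points of this tile are neighbours of [v], so the check expresses its letter by theirs. *)
Lemma parity_code_recoverable : recoverable (ball_graph d r) parity_code.
Proof.
have /card_gt0P [q0 _] : (0 < #|Q|)%N by exact: ltnW.
apply: determined_recoverable.
  by exists (fill (fun=> q0)); exact: fill_parity.
move=> v x y Xx Xy h; apply: (can_inj eK).
have [a aA av] := phi_surj (phi v).
have c0 : phi (v - a) = phi 0 by rewrite -(subrr a); apply: phi_shift.
have := etrans (Xx _ c0) (esym (Xy _ c0)).
rewrite !(bigD1_seq a) //= subrK big_seq_cond [in X in _ = _ + X]big_seq_cond.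
rewrite (eq_bigr (fun b => e (y (v - a + b)))); first exact: addIr.
move=> b /andP[bA ba]; rewrite -addrA (addrC _ b) h //.
by apply: ball_sub; [exact/eqP|exact: anticodeA].
Qed.

Let sites n : {set 'I_n * 'I_n} := [set p | phi (pt p) == phi 0]%SET.

(** Free choices off the lattice, completed by [fill], give distinct blocks; fixing [q0] on
    [sites n] makes each choice count once. *)
Lemma card_blocks_parity_code n :
  (#|Q| ^ (n ^ 2 - #|sites n|) <= #|blocks n parity_code|)%N.
Proof.
have /card_gt0P [q0 _] : (0 < #|Q|)%N by exact: ltnW.
pose ext (w : {ffun 'I_n * 'I_n -> Q}) z :=
  if [pick p | pt p == z] is Some p then w p else q0.
have extE w p : ext w (pt p) = w p.
  rewrite /ext; case: pickP => [p' /eqP|/(_ p)]; last by rewrite eqxx.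
  by move: p p' => [i j] [i' j'] [/val_inj -> /val_inj ->].
have <- : #|pffun_on q0 (mem (~: sites n)) (mem [set: Q]%SET)|
    = (#|Q| ^ (n ^ 2 - #|sites n|))%N.
  by rewrite card_pffun_on cardsT; congr (_ ^ _)%N;
    rewrite [LHS]cardsCs finset.setCK card_prod !card_ord.
rewrite -(@card_in_imset _ _ (fun w => restriction n (fill (ext w)))).
  apply: subset_leq_card; apply/fintype.subsetP => _ /imsetP[w _ ->].
  by rewrite inE; exists (fill (ext w)) => //; exact: fill_parity.
move=> w w' /pffun_onP[/supportP wS _] /pffun_onP[/supportP wS' _] /ffunP ew.
apply/ffunP => p; have [pS|pS] := boolP (p \in sites n).
  by rewrite wS ?wS' // inE pS.
have := ew p; rewrite !ffunE /fill -/(pt p) !extE.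
by move: pS; rewrite inE => /negbTE ->.
Qed.

Lemma card_sites n : (#|sites n| * #|F| <= (n + 2 * r) ^ 2)%N.
Proof.
have small c : (`|(rep c).1| <= r)%N /\ (`|(rep c).2| <= r)%N.
  by apply: box; apply: anticodeA => /=; rewrite ?rep_mem.
have lt1 (u : ('I_n * 'I_n) * F) :=
  absz_add_outer (small u.2).1 (ltn_ord u.1.1).
have lt2 (u : ('I_n * 'I_n) * F) :=
  absz_add_outer (small u.2).2 (ltn_ord u.1.2).
pose f u := (Ordinal (lt1 u).1, Ordinal (lt2 u).1).
(* Tiles centred in the box are disjoint and fit in the box enlarged by r. *)
have inj : {in finset.setX (sites n) [set: F]%SET &, injective f}.
  move=> [p c] [p' c']; rewrite !inE !andbT /= => /eqP p0 /eqP p0' [e1 e2].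
  have eq : pt p + rep c = pt p' + rep c'.
    apply: injective_projections; apply: (addIr r%:Z).
      by rewrite -[LHS](lt1 (p, c)).2 -[RHS](lt1 (p', c')).2 e1.
    by rewrite -[LHS](lt2 (p, c)).2 -[RHS](lt2 (p', c')).2 e2.
  (* Since [pt p] and [pt p'] are lattice points, the common point has both class [c] and class
     [c']. *)
  have ec : c = c'.
    rewrite -[LHS]phi_rep -[RHS]phi_rep -[rep c]add0r -[rep c']add0r.
    by rewrite -(phi_shift _ p0) -(phi_shift _ p0') eq.
  rewrite {}ec in eq *; move/addIr: eq.
  by move: p p' {p0 p0' e1 e2} => [i j] [i' j'] [/val_inj -> /val_inj ->].
have := leq_card_in f (mem (finset.setX (sites n) [set: F]%SET)) inj.
by rewrite cardsX cardsT card_prod !card_ord mulnn.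
Qed.

Lemma rate_parity_code (K : realType) :
  ((1 - 1 / #|F|%:R)%:E <= rate K parity_code)%E.
Proof.
(* Here (n + 2r)^2 - n^2 = 4rn + 4r^2, and 4r^2 <= 4r^2 n once n >= 1; hence the separate case n = 0
   below. *)
apply: (@rate_ge _ _ _ _ (4 * r + 4 * r ^ 2)%N) => //.
  by apply/card_gt0P; exists (phi 0).
move=> n; exists (n ^ 2 - #|sites n|)%N; first exact: card_blocks_parity_code.
have := card_sites n.
have : (#|sites n| <= n ^ 2)%N.
  by apply: leq_trans (max_card _) _; rewrite card_prod !card_ord.
case: n => [|n]; first by rewrite mul0n.
nia.
Qed.

End ParityCode.

Lemma capacity_perfect (K : realType) :
  capacity K Q (ball_graph d r) = (1 - 1 / #|F|%:R)%:E.
Proof.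
apply/eqP; rewrite eq_le; apply/andP; split.
  by apply: ge_ereal_sup => _ [X rX <-]; exact: rate_perfect_le.
(* The alphabet is identified with Z/q; the form [.-1.+1] gives the ordinal type its addition. *)
pose e (q : Q) : 'I_#|Q|.-1.+1 := inord (enum_rank q).
have Q1 : #|Q|.-1.+1 = #|Q| by rewrite prednK // ltnW.
have e_inj : injective e.
  move=> q q' /(congr1 (@nat_of_ord _)); rewrite !inordK ?Q1 // => /val_inj.
  exact: enum_rank_inj.
have [e' eK e'K] : bijective e by apply: inj_card_bij; rewrite ?card_ord ?Q1.
apply: (le_trans (rate_parity_code e'K K)).
apply: ereal_sup_ubound; exists (parity_code e) => //.
exact: parity_code_recoverable eK e'K.
Qed.

End Recoverable.
End Perfect.

(** * Residues, and the square tiling for the maximum metric *)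

Definition residue (m : nat) (x : int) : 'I_m.+1 := inord `|(x %% m.+1%:Z)%Z|.

Lemma residue_eqP m x y :
  residue m x = residue m y <-> exists k : int, x - y = k * m.+1%:Z.
Proof.
have lt z : (`|(z %% m.+1%:Z)%Z|%N < m.+1)%N.
  by rewrite -ltz_nat gez0_abs ?modz_ge0 // ltz_pmod.
split=> [/(congr1 (@nat_of_ord _))|[k e]].
  rewrite !inordK // => /(congr1 Posz); rewrite !gez0_abs ?modz_ge0 // => /eqP.
  by rewrite eqz_mod_dvd => /dvdzP.
congr (inord `|_|%N); apply/eqP; rewrite eqz_mod_dvd.
by apply/dvdzP; exists k.
Qed.

Lemma d1_sub u v : d1 u v = d1 (u - v) 0.
Proof. by rewrite /d1 /= !subr0. Qed.

Lemma dinf_sub u v : dinf u v = dinf (u - v) 0.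
Proof. by rewrite /dinf /= !subr0. Qed.

Lemma dinf_le_d1 u v : (dinf u v <= d1 u v)%N.
Proof. by rewrite /dinf /d1 geq_max leq_addr leq_addl. Qed.

Section Linf.
Variable r : nat.

Definition linf_class (z : Z2) : 'I_r.+1 * 'I_r.+1 :=
  (residue r z.1, residue r z.2).

Definition linf_tile : seq Z2 :=
  [seq (i%:Z, j%:Z) | i <- iota 0 r.+1, j <- iota 0 r.+1].

Lemma linf_class_shift u v w :
  linf_class u = linf_class v -> linf_class (u + w) = linf_class (v + w).
Proof.
move=> [/residue_eqP[k e] /residue_eqP[l f]].
by congr pair; apply/residue_eqP; [exists k|exists l];
  rewrite /= opprD addrACA subrr addr0.
Qed.

(** The lattice is (r + 1) Z^2, and a nonzero multiple of r + 1 has absolute value greater than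
    r. *)
Lemma linf_class_sep u v :
  linf_class u = linf_class v -> u <> v -> (r < dinf u v)%N.
Proof.
move=> [/residue_eqP[k e] /residue_eqP[l f]] ne.
rewrite ltnNge; apply/negP; rewrite /dinf e f geq_max => /andP[kr lr].
apply: ne; apply: injective_projections; apply/eqP; rewrite -subr_eq0.
  have -> : u.1 - v.1 = k * r.+1%:Z by [].
  by have -> : k = 0 by nia.
have -> : u.2 - v.2 = l * r.+1%:Z by [].
by have -> : l = 0 by nia.
Qed.

Lemma uniq_linf_tile : uniq linf_tile.
Proof.
by apply: allpairs_uniq => [||[a b] [a' b'] _ _ [-> ->]]; rewrite ?iota_uniq.
Qed.

Lemma size_linf_tile : size linf_tile = #|{: 'I_r.+1 * 'I_r.+1}|.
Proof. by rewrite size_allpairs !size_iota card_prod card_ord. Qed.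

Lemma mem0_linf_tile : 0 \in linf_tile.
Proof. by apply/allpairsP; exists (0, 0)%N; split; rewrite ?mem_iota. Qed.

Lemma linf_tile_anticode : anticode dinf r [set` linf_tile].
Proof.
move=> u v /=.
move=> /allpairsP[[a b] [ha hb ->]] /allpairsP[[a' b'] [ha' hb' ->]].
by move: ha hb ha' hb'; rewrite !mem_iota /dinf /=; lia.
Qed.

End Linf.

(** * The l1 metric, even diameter *)

Section EvenL1.
Variable t : nat.

(** The class of 0 is the perfect Lee code of radius [t]; the modulus 2t^2 + 2t + 1 is the size of
    the l1 ball. *)
Definition even_class (z : Z2) : 'I_(2 * t ^ 2 + 2 * t).+1 :=
  residue _ (z.1 + (2 * t + 1)%:Z * z.2).

(* The l1 ball of radius [t], split by the parity of i + j + t. *)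
Definition even_tile : seq Z2 :=
  [seq (a%:Z - b%:Z, a%:Z + b%:Z - t%:Z) | a <- iota 0 t.+1, b <- iota 0 t.+1]
  ++ [seq (a%:Z - b%:Z, a%:Z + b%:Z + 1 - t%:Z) | a <- iota 0 t, b <- iota 0 t].

Lemma even_class_shift u v w :
  even_class u = even_class v -> even_class (u + w) = even_class (v + w).
Proof.
move=> /residue_eqP[k e]; apply/residue_eqP; exists k; rewrite -e /=; ring.
Qed.

Lemma even_class_sep u v :
  even_class u = even_class v -> u <> v -> (2 * t < d1 u v)%N.
Proof.
move=> /residue_eqP[k e] ne; rewrite ltnNge; apply/negP; rewrite /d1 => le.
apply: ne; move: u v e le => [a b] [a' b'] /=.
set i := a - a'; set j := b - b' => e le.
have e' : i + (2 * t%:Z + 1) * j = k * (2 * t%:Z ^+ 2 + 2 * t%:Z + 1).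
  transitivity (a + (2 * t + 1)%:Z * b - (a' + (2 * t + 1)%:Z * b')).
    by rewrite /i /j PoszD PoszM; ring.
  by rewrite e -addn1 !PoszD !PoszM; ring.
(* The coordinates of (i, j) in the basis (t + 1, t), (- t, t + 1) of the
   lattice; the tilted coordinates i + j and i - j are then x (2t + 1) + y
   and x - y (2t + 1). *)
pose x := (t%:Z + 1) * k - j; pose y := j - t%:Z * k.
have ix : i = x * (t%:Z + 1) - y * t%:Z.
  have -> : i = k * (2 * t%:Z ^+ 2 + 2 * t%:Z + 1) - (2 * t%:Z + 1) * j.
    by rewrite -e'; ring.
  by rewrite /x /y; ring.
have jx : j = x * t%:Z + y * (t%:Z + 1) by rewrite /x /y; ring.
have [] : x = 0 /\ y = 0.
  move: x y ix jx le => x y -> -> le {i j e e' k a b a' b'}.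
  (* Both bounds hold because |i| + |j| is the larger of |i + j| and |i - j|. *)
  have lu : `|x * (2 * t%:Z + 1) + y| <= 2 * t%:Z by lia.
  have lv : `|x - y * (2 * t%:Z + 1)| <= 2 * t%:Z by lia.
  (* If x is nonzero, the first bound forces y to be nonzero of opposite sign; if y is nonzero, the
     second forces x to be nonzero of the same sign. *)
  by split; nia.
by move=> x0 y0; move: ix jx; rewrite x0 y0 /i /j => ? ?; congr pair; lia.
Qed.

Lemma uniq_even_tile : uniq even_tile.
Proof.
rewrite cat_uniq; apply/and3P; split.
- apply: allpairs_uniq => [||[a b] [a' b'] _ _ /= [e f]]; rewrite ?iota_uniq //.
  by congr pair; lia.
- apply/hasPn => _ /allpairsP[[a b] [_ _ ->]].
  by apply/allpairsP => -[[a' b'] [_ _ /= [e f]]]; lia.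
- apply: allpairs_uniq => [||[a b] [a' b'] _ _ /= [e f]]; rewrite ?iota_uniq //.
  by congr pair; lia.
Qed.

Lemma size_even_tile : size even_tile = #|'I_(2 * t ^ 2 + 2 * t).+1|.
Proof. by rewrite size_cat !size_allpairs !size_iota card_ord; lia. Qed.

Lemma mem0_even_tile : 0 \in even_tile.
Proof.
(* At the origin i + j + t = t, so it lies in the first half exactly for even [t]. *)
rewrite mem_cat; apply/orP; have [odd_t|even_t] := boolP (odd t); [right|left];
  apply/allpairsP; exists (t./2, t./2); split; rewrite ?mem_iota /=;
  first [by congr pair; lia | by lia].
Qed.

Lemma even_tile_anticode : anticode d1 (2 * t) [set` even_tile].
Proof.
move=> u v.
change (u \in even_tile -> v \in even_tile -> d1 u v <= 2 * t)%N.
rewrite mem_cat [v \in _]mem_cat.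
by move=> /orP[] /allpairsP[[a b] [ha hb ->]] /orP[]
  /allpairsP[[a' b'] [ha' hb' ->]]; move: ha hb ha' hb';
  rewrite !mem_iota /d1 /=; lia.
Qed.

End EvenL1.

(** * The l1 metric, odd diameter *)

Section OddL1.
Variable t : nat.

(** The class of 0 is the checkerboard lattice of points with even coordinate sum, scaled by t + 1;
    its index is 2 (t + 1)^2. *)
Definition odd_class (z : Z2) : 'I_(2 * t).+2 * 'I_t.+1 :=
  (residue _ (z.1 + z.2), residue _ z.1).

(* The points with 0 <= i + j <= 2t + 1 and 0 <= i - j <= 2t + 1, split by the
   parity of i + j. *)
Definition odd_tile : seq Z2 :=
  [seq (a%:Z + b%:Z, a%:Z - b%:Z) | a <- iota 0 t.+1, b <- iota 0 t.+1]
  ++ [seq (a%:Z + b%:Z + 1, a%:Z - b%:Z) | a <- iota 0 t.+1, b <- iota 0 t.+1].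

Lemma odd_class_shift u v w :
  odd_class u = odd_class v -> odd_class (u + w) = odd_class (v + w).
Proof.
move=> [/residue_eqP[k e] /residue_eqP[l f]].
congr pair; apply/residue_eqP; [exists k|exists l]; rewrite -?e -?f /=; ring.
Qed.

Lemma odd_class_sep u v :
  odd_class u = odd_class v -> u <> v -> ((2 * t).+1 < d1 u v)%N.
Proof.
move=> [/residue_eqP[k e] /residue_eqP[l f]] ne.
rewrite ltnNge; apply/negP; rewrite /d1 => le.
move: u v e f le ne => [a b] [a' b'] /= e f le.
have g : b - b' = (2 * k - l) * t.+1%:Z.
  have -> : b - b' = a + b - (a' + b') - (a - a') by ring.
  have e2 : (2 * t).+2%:Z = 2 * t.+1%:Z by lia.
  by rewrite e f e2; ring.
have le' : (`|l| + `|(2 * k - l)%R| < 2)%N.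
  rewrite f g !abszM -mulnDl in le; rewrite ltnNge; apply/negP => ge2.
  by have := leq_mul ge2 (leqnn t.+1); lia.
(* As l and 2k - l have the same parity, their absolute values have an even sum, and below 2 it is
   0. *)
have [l0 k0] : l = 0 /\ k = 0 by lia.
by apply; rewrite l0 k0 mul0r in e f; congr pair; lia.
Qed.

Lemma uniq_odd_tile : uniq odd_tile.
Proof.
rewrite cat_uniq; apply/and3P; split.
- apply: allpairs_uniq => [||[a b] [a' b'] _ _ /= [e f]]; rewrite ?iota_uniq //.
  by congr pair; lia.
- apply/hasPn => _ /allpairsP[[a b] [_ _ ->]].
  by apply/allpairsP => -[[a' b'] [_ _ /= [e f]]]; lia.
- apply: allpairs_uniq => [||[a b] [a' b'] _ _ /= [e f]]; rewrite ?iota_uniq //.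
  by congr pair; lia.
Qed.

Lemma size_odd_tile : size odd_tile = #|{: 'I_(2 * t).+2 * 'I_t.+1}|.
Proof.
by rewrite size_cat !size_allpairs !size_iota card_prod !card_ord; lia.
Qed.

Lemma mem0_odd_tile : 0 \in odd_tile.
Proof.
by rewrite mem_cat; apply/orP; left; apply/allpairsP; exists (0, 0)%N;
  split; rewrite ?mem_iota.
Qed.

Lemma odd_tile_anticode : anticode d1 (2 * t).+1 [set` odd_tile].
Proof.
move=> u v.
change (u \in odd_tile -> v \in odd_tile -> d1 u v <= (2 * t).+1)%N.
rewrite mem_cat [v \in _]mem_cat.
by move=> /orP[] /allpairsP[[a b] [ha hb ->]] /orP[]
  /allpairsP[[a' b'] [ha' hb' ->]]; move: ha hb ha' hb';
  rewrite !mem_iota /d1 /=; lia.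
Qed.

End OddL1.

Theorem theorem5p2 (K : realType) (Q : finType) (hQ : (2 <= #|Q|)%N)
    (r : nat) (hr : (1 <= r)%N) :
  exists D1 : nat,
    [/\ max_anticode_size d1 r D1,
        capacity K Q (ball_graph d1 r) = (1 - 1 / D1%:R)%:E,
        capacity K Q (ball_graph dinf r) = (1 - 1 / (r%:R + 1) ^+ 2)%:E
      & D1%:R = (if odd r then (r%:R + 1) ^+ 2 / 2
                 else r%:R ^+ 2 / 2 + r%:R + 1) :> K].
Proof.
have linf : capacity K Q (ball_graph dinf r) = (1 - 1 / (r%:R + 1) ^+ 2)%:E.
  rewrite (capacity_perfect _ dinf_sub _ (@linf_class_shift r)
    (@linf_class_sep r) (uniq_linf_tile r) (size_linf_tile r)
    (mem0_linf_tile r) (@linf_tile_anticode r)) //.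
  by rewrite card_prod card_ord mulnn natrX -natr1.
rewrite linf; have := odd_double_half r; rewrite -muln2 mulnC.
(* With [t] standing for [r./2], the case r = 2t + 1 comes first, then r = 2t. *)
case: (odd r) (r./2) => t <- /=; rewrite ?add0n ?add1n.
  exists #|{: 'I_(2 * t).+2 * 'I_t.+1}|; split=> //.
  - exact: perfect_max_anticode_size (@odd_class_sep t) (uniq_odd_tile t)
      (size_odd_tile t) (@odd_tile_anticode t).
  - exact: (capacity_perfect _ d1_sub dinf_le_d1 (@odd_class_shift t)
      (@odd_class_sep t) (uniq_odd_tile t) (size_odd_tile t)
      (mem0_odd_tile t) (@odd_tile_anticode t)).
  - by rewrite card_prod !card_ord natrM -!natr1 natrM; field.
exists #|'I_(2 * t ^ 2 + 2 * t).+1|; split=> //.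
- exact: perfect_max_anticode_size (@even_class_sep t) (uniq_even_tile t)
    (size_even_tile t) (@even_tile_anticode t).
- exact: (capacity_perfect _ d1_sub dinf_le_d1 (@even_class_shift t)
    (@even_class_sep t) (uniq_even_tile t) (size_even_tile t)
    (mem0_even_tile t) (@even_tile_anticode t)).
- by rewrite card_ord -natr1 natrD !natrM; field.
Qed.
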